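(* Let $\{S_{\mathbf{x}}(f)\}$ be temporal spectral densities on $\Omega$ indexed by spatial locations $\mathbf{x}\in\mathbb{R}^d$, and let $\mathbf{u}\in\mathbb{R}^d$ be a fixed vector. If $C_f(\mathbf{x},\mathbf{x}')$ is a real-valued correlation function (in $(\mathbf{x},\mathbf{x}')$, for each $f\in\Omega$) and $g(f)$ is an odd real-valued function on $\Omega$, then $$K((t,\mathbf{x}),(t',\mathbf{x}'))=\int_\Omega e^{\,i2\pi f(t-t')+i g(f)\,\mathbf{u}^T(\mathbf{x}-\mathbf{x}')}\,\sqrt{S_{\mathbf{x}}(f)\,S_{\mathbf{x}'}(f)}\;C_f(\mathbf{x},\mathbf{x}')\,\mathrm{d}f$$ defines a valid covariance function for a spatially nonstationary real-valued space-time process $Z(t,\mathbf{x})$.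
   Context: Here $\Omega=[-\tfrac{1}{2\Delta t},\tfrac{1}{2\Delta t})$ for discrete-time data with sampling interval $\Delta t>0$ (times $t,t'\in\Delta t\,\mathbb{Z}$), or $\Omega=\mathbb{R}$ for continuous-time data (times $t,t'\in\mathbb{R}$). A temporal spectral density on $\Omega$ is a nonnegative, integrable function $S:\Omega\to[0,\infty)$ that is symmetric about zero, $S(-f)=S(f)$. A real-valued correlation function is a symmetric function $C:\mathbb{R}^d\times\mathbb{R}^d\to\mathbb{R}$ with $C(\mathbf{x},\mathbf{x})=1$ for all $\mathbf{x}$ that is positive semidefinite: $\sum_{j,k=1}^n a_j a_k C(\mathbf{x}_j,\mathbf{x}_k)\ge 0$ for all $n$, all $\mathbf{x}_1,\dots,\mathbf{x}_n\in\mathbb{R}^d$ and all $a_1,\dots,a_n\in\mathbb{R}$. It need not be stationary (a function of $\mathbf{x}-\mathbf{x}'$ only). Oddness of $g$ means $g(-f)=-g(f)$. A valid covariance function for a real-valued process is a real-valued symmetric function $K$ of pairs of space-time points that is positive semidefinite: $\sum_{j,k=1}^n a_j a_k K((t_j,\mathbf{x}_j),(t_k,\mathbf{x}_k))\ge 0$ for all $n$, all space-time points $(t_j,\mathbf{x}_j)$ and all $a_j\in\mathbb{R}$. ''Spatially nonstationary'' means that $K$ is not required to depend on $\mathbf{x},\mathbf{x}'$ only through $\mathbf{x}-\mathbf{x}'$.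
   Formalization: The formal theorem additionally assumes that C_f(x,x') is even in f on Ω, without which K need not be real-valued, and that g(f) and C_f(x,x') are measurable in f, so that the integral makes sense. *)

(* Defs.v *)
From mathcomp Require Export all_boot all_order all_algebra.
From mathcomp Require Export all_classical all_reals all_analysis.
From mathcomp.real_closed Require Export complex.

Set Implicit Arguments.
Unset Strict Implicit.
Unset Printing Implicit Defensive.

Export Order.TTheory GRing.Theory Num.Theory.

#[global] Open Scope classical_set_scope.
#[global] Open Scope complex_scope.
#[global] Open Scope ring_scope.

Section ComplexIntegration.
Context {d : measure_display} {T : measurableType d} {R : realType}.
Variable mu : {measure set T -> \bar R}.

Definition cexp (z : R[i]) : R[i] :=
  (expR (complex.Re z))%:C * (cos (complex.Im z) +i* sin (complex.Im z)).

Definition cintegrable (D : set T) (F : T -> R[i]) : Prop :=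
  mu.-integrable D (EFin \o (fun s => complex.Re (F s))) /\
  mu.-integrable D (EFin \o (fun s => complex.Im (F s))).

Definition cintegral (D : set T) (F : T -> R[i]) : R[i] :=
  Rintegral mu D (fun s => complex.Re (F s))
    +i* Rintegral mu D (fun s => complex.Im (F s)).

End ComplexIntegration.

Section PositiveSemidefinite.
Context {R : realType} {P : Type}.

Definition symmetric_on (D : set P) (K : P -> P -> R) : Prop :=
  forall p q, D p -> D q -> K p q = K q p.

Definition positive_semidefinite_on (D : set P) (K : P -> P -> R) : Prop :=
  forall (n : nat) (p : 'I_n -> P) (a : 'I_n -> R), (forall j, D (p j)) ->
    0 <= \sum_(j < n) \sum_(k < n) a j * a k * K (p j) (p k).

Definition covariance_function_on (D : set P) (K : P -> P -> R) : Prop :=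
  symmetric_on D K /\ positive_semidefinite_on D K.

Definition correlation_function (C : P -> P -> R) : Prop :=
  covariance_function_on setT C /\ forall x, C x x = 1.

End PositiveSemidefinite.

Section TimeAndFrequency.
Context {R : realType}.

Inductive sampling : Type :=
| Discrete of {posnum R}
| Continuous.

Definition time_set (s : sampling) : set R :=
  match s with
  | Discrete dt => [set dt%:num * k%:~R | k in [set: int]]
  | Continuous => setT
  end.

Definition frequency_set (s : sampling) : set R :=
  match s with
  | Discrete dt => [set` `[- (1 / (2 * dt%:num)), 1 / (2 * dt%:num)[%R]
  | Continuous => setT
  end.

(* Functions of frequency are total on R, but only their values on Omega matter.
   Omega may be half-open, so evenness and oddness on Omega constrain
   exactly the f for which both f and - f lie in Omega. *)
Definition even_on (Omega : set R) (S : R -> R) : Prop :=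
  forall f, Omega f -> Omega (- f) -> S (- f) = S f.

Definition odd_on (Omega : set R) (g : R -> R) : Prop :=
  forall f, Omega f -> Omega (- f) -> g (- f) = - g f.

Definition spectral_density (Omega : set R) (S : R -> R) : Prop :=
  [/\ forall f, Omega f -> 0 <= S f,
      (@lebesgue_measure R).-integrable Omega (EFin \o S) &
      even_on Omega S].

End TimeAndFrequency.
Arguments sampling : clear implicits.

Section HalfSpectralModel.
Context {R : realType} {d : nat}.
Variables (Omega : set R) (S : 'cV[R]_d -> R -> R) (u : 'cV[R]_d).
Variables (C : R -> 'cV[R]_d -> 'cV[R]_d -> R) (g : R -> R).

Definition half_spectral_integrand (p p' : R * 'cV[R]_d) (f : R) : R[i] :=
  let: (t, x) := p in let: (t', x') := p' in
  cexp ('i%C * (2 * pi * f * (t - t'))%:C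
        + 'i%C * (g f * (u^T *m (x - x')) ord0 ord0)%:C)
  * (Num.sqrt (S x f * S x' f))%:C * (C f x x')%:C.

(* Complex-valued a priori: the imaginary part of the integrand is an odd
   function of f when S x, S x' and f |-> C f x x' are even and g is odd. *)
Definition half_spectral_kernel (p p' : R * 'cV[R]_d) : R[i] :=
  cintegral (@lebesgue_measure R) Omega (half_spectral_integrand p p').

End HalfSpectralModel.

(* Main.v *)
(* The real part of the integrand is even in f and the imaginary part odd, so
   the kernel is the real integral of
     cos (theta_p f - theta_p' f) sqrt (S_x S_x') C_f(x, x'),
   where theta_p f is the phase at the space-time point p. For each f the
   cosine splits as cos cos + sin sin, so the quadratic form of the integrand
   is a sum of two quadratic forms of C_f, hence nonnegative. Integrability
   follows from |C_f| <= 1 and sqrt (S_x S_x') <= S_x + S_x'. *)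
Require Import Defs.
From mathcomp Require Import measurable_realfun ring lra.
Import numFieldNormedType.Exports.

Section RealIntegrals.
Context {R : realType}.
Local Notation mu := (@lebesgue_measure R).

Lemma integrable_sum_EFin {d} {T : measurableType d}
    (m : {measure set T -> \bar R}) (D : set T) (I : Type) (r : seq I)
    (h : I -> T -> R) : measurable D ->
  (forall i, m.-integrable D (EFin \o h i)) ->
  m.-integrable D (EFin \o (fun x => \sum_(i <- r) h i x)).
Proof.
move=> mD ih.
rewrite (_ : _ \o _ = fun x => (\sum_(i <- r) (EFin \o h i) x)%E).
  exact: integrable_sum.
by apply/funext => x /=; rewrite sumEFin.
Qed.

Lemma Rintegral_sum {d} {T : measurableType d} (m : {measure set T -> \bar R})
    (D : set T) (I : Type) (r : seq I) (h : I -> T -> R) : measurable D ->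
  (forall i, m.-integrable D (EFin \o h i)) ->
  Rintegral m D (fun x => \sum_(i <- r) h i x) =
  \sum_(i <- r) Rintegral m D (h i).
Proof.
move=> mD ih; elim: r => [|i r IHr].
  rewrite big_nil (_ : (fun x => _) = cst 0) ?Rintegral_cst ?mul0r//.
  by apply/funext => x; rewrite big_nil.
rewrite big_cons -IHr -RintegralD//.
  by apply: eq_Rintegral => x _; rewrite big_cons.
exact: integrable_sum_EFin.
Qed.

(** Since [D] is symmetric, extending [h] by zero keeps it odd on the whole line. Reflection
    preserves Lebesgue measure, so the integral equals its own opposite. *)
Lemma Rintegral_odd (D : set R) (h : R -> R) : measurable D ->
  mu.-integrable D (EFin \o h) ->
  (forall x, D x -> D (- x)) -> (forall x, D x -> h (- x) = - h x) ->
  Rintegral mu D h = 0.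
Proof.
move=> mD ih DN hN; rewrite Rintegral_mkcond.
set k : R -> R := patch (fun=> 0) D h.
have kN x : k (- x) = - k x.
  rewrite /k !patchE; case: ifPn => [/set_mem/DN|/negP xD].
    by rewrite opprK => Dx; rewrite hN// mem_set.
  by rewrite ifN ?oppr0//; apply/negP => /set_mem/DN Dx; apply/xD/mem_set.
have ik : mu.-integrable setT (EFin \o k).
  have := (@integrable_mkcond _ _ _ mu _ (EFin \o h) mD).1 ih.
  by rewrite restrict_EFin.
have ikN : mu.-integrable setT (EFin \o (fun x => - k x)).
  exact: integrableN ik.
suff : Rintegral mu setT k = - Rintegral mu setT k by lra.
have -> : - Rintegral mu setT k = Rintegral mu setT (fun x => - k x).
  by rewrite -mulN1r -RintegralZl//; apply: eq_Rintegral => x _; rewrite mulN1r.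
rewrite /Rintegral; congr fine.
have mN : measurable_fun setT (-%R : measurableTypeR R -> measurableTypeR R).
  exact: oppr_measurable.
(* Change of variable [x] to [- x]: [mu] is replaced by its image under negation. *)
rewrite (eq_measure_integral (pushforward mu (-%R : R -> measurableTypeR R))).
  rewrite integral_pushforward//; first last.
  - by rewrite preimage_setT (_ : _ \o _ = EFin \o (fun x => - k x))//;
      apply/funext => x /=; rewrite kN.
  - exact: measurable_int ik.
  by rewrite preimage_setT; apply: eq_integral => x _ /=; rewrite kN.
by move=> A mA _; apply/esym/lebesgue_measureN.
Qed.

(** Domination by [A + B]: the outer factors are at most 1 in absolute value, and
    [A * B <= (A + B) ^+ 2] for nonnegative values. Leaving [tr] abstract serves cosine and sine at
    once. *)
Lemma integrable_bounded_sqrtM (D : set R) (A B c theta tr : R -> R) :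
  measurable D ->
  (forall f, D f -> 0 <= A f) -> (forall f, D f -> 0 <= B f) ->
  mu.-integrable D (EFin \o A) -> mu.-integrable D (EFin \o B) ->
  measurable_fun D c -> (forall f, D f -> `|c f| <= 1) ->
  measurable_fun D theta -> continuous tr -> (forall y, `|tr y| <= 1) ->
  mu.-integrable D
    (EFin \o (fun f => tr (theta f) * Num.sqrt (A f * B f) * c f)).
Proof.
move=> mD A0 B0 iA iB mc c1 mth ctr tr1.
have mA : measurable_fun D A by have /measurable_EFinP := measurable_int _ iA.
have mB : measurable_fun D B by have /measurable_EFinP := measurable_int _ iB.
have iAB := @integrableD _ _ _ mu D mD _ _ iA iB.
apply: (@le_integrable _ _ _ mu D mD _ _ _ _ iAB).
  apply/measurable_EFinP; apply: measurable_funM => //.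
  apply: measurable_funM.
    by apply: (measurableT_comp _ mth); apply: continuous_measurable_fun.
  apply: measurableT_comp; last exact: measurable_funM.
  exact: (continuous_measurable_fun (@sqrt_continuous R)).
move=> f Df /=; have Af := A0 f Df; have Bf := B0 f Df.
rewrite lee_fin (ger0_norm (addr_ge0 Af Bf)) !normrM.
have sAB : `|Num.sqrt (A f * B f)| <= A f + B f.
  rewrite ger0_norm ?sqrtr_ge0// -(ger0_norm (addr_ge0 Af Bf)) -sqrtr_sqr.
  by rewrite ler_wsqrtr//; nra.
rewrite -[leRHS]mul1r -[leRHS]mulr1.
by rewrite ler_pM ?mulr_ge0// ?c1// ler_pM.
Qed.

Lemma measurable_frequency_set (s : sampling R) : measurable (frequency_set s).
Proof. by case: s => [dt|]; [exact: measurable_itv|exact: measurableT]. Qed.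

End RealIntegrals.

Section PositiveSemidefiniteKernels.
Context {R : realType} {P : Type}.

(** Positivity on the two points [x], [y] with coefficients 1 and [e] is tested at [e = 1] and
    [e = -1]. *)
Lemma correlation_function_le1 (C : P -> P -> R) x y :
  correlation_function C -> `|C x y| <= 1.
Proof.
move=> [[Csym Cpos] C1].
have C2 e : 0 <= 1 + e ^+ 2 + 2 * e * C x y.
  have := Cpos 2 (fun i => if i == 0 then x else y)
    (fun i => if i == 0 then 1 else e) (fun _ => I).
  rewrite !big_ord_recl !big_ord0 /= !C1 (Csym y x)//; lra.
by rewrite ler_norml; have := C2 1; have := C2 (-1); lra.
Qed.

(** The cosine of a difference is a sum of two products of one-point factors. These factors and the
    weights [w] are absorbed into the coefficients, which leaves two quadratic forms of [C]. *)
Lemma positive_semidefinite_cos (C : P -> P -> R) (n : nat) (p : 'I_n -> P)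
    (a w theta : 'I_n -> R) : positive_semidefinite_on setT C ->
  0 <= \sum_(j < n) \sum_(k < n)
     a j * a k * (cos (theta j - theta k) * (w j * w k) * C (p j) (p k)).
Proof.
move=> Cpos.
have := addr_ge0
  (Cpos n p (fun j => a j * w j * cos (theta j)) (fun _ => I))
  (Cpos n p (fun j => a j * w j * sin (theta j)) (fun _ => I)).
rewrite -big_split/=; congr (0 <= _); apply: eq_bigr => j _.
rewrite -big_split/=; apply: eq_bigr => k _.
by rewrite cosB; ring.
Qed.

End PositiveSemidefiniteKernels.

Section HalfSpectral.
Context {R : realType} {d : nat}.

(** A phase attached to a single point: the exponent of the model is ['i] times a difference of two
    such phases, as the cosine subtraction formula requires. *)
Definition phase (u : 'cV[R]_d) (g : R -> R) (p : R * 'cV[R]_d) (f : R) : R :=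
  2 * pi * f * p.1 + g f * (u^T *m p.2) ord0 ord0.

Lemma half_spectral_integrandE (S : 'cV[R]_d -> R -> R) (u : 'cV[R]_d)
    (C : R -> 'cV[R]_d -> 'cV[R]_d -> R) (g : R -> R) p p' f :
  half_spectral_integrand S u C g p p' f =
    (cos (phase u g p f - phase u g p' f)
       * Num.sqrt (S p.2 f * S p'.2 f) * C f p.2 p'.2)
    +i* (sin (phase u g p f - phase u g p' f)
       * Num.sqrt (S p.2 f * S p'.2 f) * C f p.2 p'.2).
Proof.
case: p p' => [t x] [t' x']; rewrite /half_spectral_integrand /cexp /phase.
rewrite mulmxBr !mxE /=.
set a := \sum_j _; set b := \sum_j _.
rewrite (_ : _ + g f * a - _ = 2 * pi * f * (t - t') + g f * (a - b));
  last by ring.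
by simpc; rewrite expR0 !mul1r.
Qed.

Lemma measurable_phase (D : set R) u g p : measurable_fun D g ->
  measurable_fun D (phase u g p).
Proof.
by move=> mg; apply: measurable_funD; apply: measurable_funM.
Qed.

End HalfSpectral.

Theorem theorem1 (R : realType) (d : nat) (s : sampling R)
    (S : 'cV[R]_d -> R -> R) (u : 'cV[R]_d)
    (C : R -> 'cV[R]_d -> 'cV[R]_d -> R) (g : R -> R) :
  (forall x, spectral_density (frequency_set s) (S x)) ->
  (forall f, frequency_set s f -> correlation_function (C f)) ->
  (forall x x', measurable_fun (frequency_set s) (fun f => C f x x')) ->
  (forall x x', even_on (frequency_set s) (fun f => C f x x')) ->
  measurable_fun (frequency_set s) g ->
  odd_on (frequency_set s) g ->
  (forall p p', (time_set s `*` setT) p -> (time_set s `*` setT) p' ->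
     cintegrable (@lebesgue_measure R) (frequency_set s)
       (half_spectral_integrand S u C g p p')) /\
  exists K : R * 'cV[R]_d -> R * 'cV[R]_d -> R,
    (forall p p', (time_set s `*` setT) p -> (time_set s `*` setT) p' ->
       half_spectral_kernel (frequency_set s) S u C g p p' = (K p p')%:C) /\
    covariance_function_on (time_set s `*` setT) K.
Proof.
move=> hS hC mC evC mg odg.
have mO := measurable_frequency_set s.
(* With [tr] equal to [cos] or [sin], this is the real or imaginary part of the integrand. *)
pose term (tr : R -> R) p p' f : R := tr (phase u g p f - phase u g p' f)
       * Num.sqrt (S p.2 f * S p'.2 f) * C f p.2 p'.2.
have iterm tr p p' : continuous tr -> (forall y, `|tr y| <= 1) ->
    (@lebesgue_measure R).-integrable (frequency_set s) (EFin \o term tr p p').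
  move=> ctr tr1; have [Sp0 iSp _] := hS p.2; have [Sp'0 iSp' _] := hS p'.2.
  apply: integrable_bounded_sqrtM => //.
  - by move=> f Of; apply/correlation_function_le1/hC.
  - by apply: measurable_funB; apply: measurable_phase.
have icos p p' := iterm _ p p' (@continuous_cos R)
  (fun y => ltac:(by rewrite ler_norml cos_geN1 cos_le1)).
have isin p p' := iterm _ p p' (@continuous_sin R)
  (fun y => ltac:(by rewrite ler_norml sin_geN1 sin_le1)).
have ReE p p' : (fun f => complex.Re (half_spectral_integrand S u C g p p' f))
    = term cos p p'.
  by apply/funext => f; rewrite half_spectral_integrandE.
have ImE p p' : (fun f => complex.Im (half_spectral_integrand S u C g p p' f))
    = term sin p p'.
  by apply/funext => f; rewrite half_spectral_integrandE.
have oddsin p p' f : frequency_set s f -> frequency_set s (- f) ->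
    term sin p p' (- f) = - term sin p p' f.
  move=> Of ONf; have [_ _ eSp] := hS p.2; have [_ _ eSp'] := hS p'.2.
  (* The amplitude is even in [f], so only the phase difference changes sign. *)
  rewrite /term eSp// eSp'// evC// -!mulNr -sinN; congr (sin _ * _ * _).
  by rewrite /phase odg//; ring.
split=> [p p' _ _|]; first by rewrite /cintegrable ReE ImE.
(* The witness is the real part of the kernel; agreement with the kernel then amounts to a vanishing
   sine integral. *)
exists (fun p p' => Rintegral lebesgue_measure (frequency_set s) (term cos p p')).
split=> [p p' _ _|].
  rewrite /half_spectral_kernel /cintegral ReE ImE; congr (_ +i* _).
  case: s {hS hC mC evC mg odg iterm icos} mO isin oddsin => [dt|] mO isin oddsin.
    (* The endpoint -1/(2 dt), whose opposite is not in Omega, is negligible. *)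
    have iO : (@lebesgue_measure R).-integrable
        `]- (1 / (2 * dt%:num)), (1 / (2 * dt%:num))[ (EFin \o term sin p p').
      apply: integrableS (isin p p') => //.
      exact: subset_itv_oo_co.
    rewrite /frequency_set -Rintegral_itv_obnd_cbnd//; apply: Rintegral_odd => //.
      by move=> f /=; rewrite !in_itv/=; lra.
    by move=> f /=; rewrite !in_itv/= => Of;
      apply: oddsin; rewrite /= in_itv/=; lra.
  by apply: Rintegral_odd => // f _; apply: oddsin.
split=> [p q _ _|n p a _].
  (* Exchanging the points negates the phase difference, which cosine does not see. *)
  apply: eq_Rintegral => f /set_mem Of.
  have [[Csym _] _] := hC f Of.
  by rewrite /term -cosN opprB (mulrC (S p.2 f)) (Csym p.2).
(* Moving the finite sums under the integral reduces positivity to a pointwise statement in [f]. *)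
pose quad f := \sum_(j < n) \sum_(k < n) a j * a k * term cos (p j) (p k) f.
have -> : \sum_(j < n) \sum_(k < n) a j * a k *
    Rintegral lebesgue_measure (frequency_set s) (term cos (p j) (p k)) =
  Rintegral lebesgue_measure (frequency_set s) quad.
  have iZ j k : (@lebesgue_measure R).-integrable (frequency_set s)
      (EFin \o (fun f => a j * a k * term cos (p j) (p k) f)).
    by have := @integrableZl _ _ _ lebesgue_measure _ mO
      (a j * a k) _ (icos (p j) (p k)).
  rewrite Rintegral_sum//; last first.
    by move=> j; apply: integrable_sum_EFin.
  apply: eq_bigr => j _; rewrite Rintegral_sum//; apply: eq_bigr => k _.
  by rewrite RintegralZl.
apply: Rintegral_ge0 => f Of; have [[_ Cpos] _] := hC f Of.
(* Nonnegativity of the densities lets the square root of the product factor into one weight per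
   point. *)
have := positive_semidefinite_cos (C f) n (fun j => (p j).2) a
  (fun j => Num.sqrt (S (p j).2 f)) (fun j => phase u g (p j) f) Cpos.
congr (0 <= _); apply: eq_bigr => j _; apply: eq_bigr => k _.
by rewrite /term sqrtrM//; have [] := hS (p j).2 => ->.
Qed.
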